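(* Let $k$ be a field of characteristic zero, let $B=k[X_{1},\ldots,X_{n}]/I=k[x_{1},\ldots,x_{n}]$ be a finitely generated $k$-domain such that $I\subset(X_1,\ldots,X_n)$, and let $\partial\in\mathrm{LND}(B)$ have kernel $\ker\partial$ finitely generated as a $k$-algebra. Let $\ker\partial$ be generated over $k$ by $z_i(x_1,\ldots,x_n)$, $i=1,\ldots,r$, where $z_i\in k[X_1,\ldots,X_n]$ and $z_i(0,\ldots,0)=0$. Let $s_i=s_i(x_1,\ldots,x_n)\in\ker\partial^2$, $i=1,\ldots,m$, where $s_i\in k[X_1,\ldots,X_n]$ and $s_i(0,\ldots,0)=0$, be such that $\partial(s_1),\ldots,\partial(s_m)$ generate the plinth ideal $\mathrm{pl}(\partial)$, so that $\ker\partial^2=(\ker\partial)s_1+\cdots+(\ker\partial)s_m+\ker\partial$. Let $d_i=\deg_\partial(x_i)$ (with all $x_i\neq0$), and let $\mathcal{G}=\{\mathcal{G}_i\}_{i\in\mathbb{N}}$ be the $\mathbb{N}$-filtration of $B$ given by $$\mathcal{G}_i=\sum_{j\le i}\ \sum_{u_1+\cdots+u_m+d_1v_1+\cdots+d_nv_n=j}(\ker\partial)\, s_1^{u_1}\cdots s_m^{u_m}x_1^{v_1}\cdots x_n^{v_n}\quad(u_a,v_b\in\mathbb{N}).$$ Let $k^{[r+n+m]}=k[Z_1,\ldots,Z_r,X_1,\ldots,X_n,S_1,\ldots,S_m]$, let $J$ be the ideal of $k^{[r+n+m]}$ generated by $I$, the elements $Z_i-z_i(X_1,\ldots,X_n)$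 ($1\le i\le r$) and the elements $S_i-s_i(X_1,\ldots,X_n)$ ($1\le i\le m$), let $\omega$ be the weighted degree on $k^{[r+n+m]}$ with $\omega(Z_i)=0$, $\omega(S_i)=1$, $\omega(X_i)=d_i$, and let $\hat J$ be the ideal generated by the highest $\omega$-homogeneous components of all elements of $J$. Then $\mathcal{G}$ is proper if and only if $\hat J$ is prime.
   Context: $\mathbb{N}=\mathbb{Z}_{\ge 0}$. A $k$-derivation $\partial$ of $B$ is locally nilpotent if for every $a\in B$ there is $N$ with $\partial^N(a)=0$; $\mathrm{LND}(B)$ is the set of these. The plinth ideal is $\mathrm{pl}(\partial)=\ker\partial\cap\partial(B)$, an ideal of $\ker\partial$. For $a\ne 0$, $\deg_\partial(a)=\min\{i\in\mathbb{N}\mid\partial^{i+1}(a)=0\}$, and $\deg_\partial(0)=-\infty$. An $\mathbb{N}$-filtration of $B$ is a family $\{\mathcal{G}_i\}_{i\in\mathbb{N}}$ of $k$-subspaces with $\mathcal{G}_i\subset\mathcal{G}_{i+1}$, $B=\bigcup_i\mathcal{G}_i$, and $\mathcal{G}_i\mathcal{G}_j\subset\mathcal{G}_{i+j}$. It is proper if, in addition, $a\in\mathcal{G}_i\setminus\mathcal{G}_{i-1}$ and $b\in\mathcal{G}_j\setminus\mathcal{G}_{j-1}$ imply $ab\in\mathcal{G}_{i+j}\setminus\mathcal{G}_{i+j-1}$ (with $\mathcal{G}_{-1}=\{0\}$). The weighted degree $\omega$ of a non-zero polynomial is the maximum of the weights of its monomials; the highest homogeneous component of a polynomial is the sum of its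 terms of maximal weight. *)

(* Defs.v *)
From HB Require Import structures.
From mathcomp Require Import all_boot all_order all_algebra.
From mathcomp Require Import mpoly.

Set Implicit Arguments.
Unset Strict Implicit.
Unset Printing Implicit Defensive.

Import GRing.Theory.
Local Open Scope ring_scope.

(* Ideals, subspaces and filtrations are Prop-valued predicates, since
   membership in them is not decidable in general. *)

Section Ideals.
Variable A : comNzRingType.

Definition ideal_gen (S : A -> Prop) (a : A) : Prop :=
  exists ts : seq (A * A),
    (forall t, t \in ts -> S t.2) /\ a = \sum_(t <- ts) t.1 * t.2.

Definition is_ideal (P : A -> Prop) : Prop :=
  [/\ P 0, forall a b, P a -> P b -> P (a + b)
    & forall a b, P b -> P (a * b)].

Definition is_prime_ideal (P : A -> Prop) : Prop :=
  [/\ is_ideal P, ~ P 1 & forall a b, P (a * b) -> P a \/ P b].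

End Ideals.

Section Algebras.
Variables (k : fieldType) (B : comAlgType k).

Definition peval (n : nat) (x : 'I_n -> B) (p : {mpoly k[n]}) : B :=
  mmap (in_alg B) x p.

(* B = k[X_1, ..., X_n]/I, with x_i the class of X_i: evaluation at x is onto
   and its kernel is I. *)
Definition is_presentation (n : nat) (x : 'I_n -> B)
    (I : {mpoly k[n]} -> Prop) : Prop :=
  (forall b, exists p, b = peval x p) /\ (forall p, I p <-> peval x p = 0).

Definition subalg_gen (r : nat) (y : 'I_r -> B) (b : B) : Prop :=
  exists q : {mpoly k[r]}, b = peval y q.

Definition is_subspace (V : B -> Prop) : Prop :=
  V 0 /\ forall (c : k) a b, V a -> V b -> V (c *: a + b).

Definition is_filtration (G : nat -> B -> Prop) : Prop :=
  [/\ forall i, is_subspace (G i),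
      forall i a, G i a -> G i.+1 a,
      forall a, exists i, G i a
    & forall i j a b, G i a -> G j b -> G (i + j)%N (a * b)].

(* G_i \ G_{i-1}, with G_{-1} = {0}. *)
Definition filt_exact (G : nat -> B -> Prop) (i : nat) (a : B) : Prop :=
  G i a /\ ~ (if i is j.+1 then G j a else a = 0).

Definition is_proper (G : nat -> B -> Prop) : Prop :=
  is_filtration G /\
  forall i j a b, filt_exact G i a -> filt_exact G j b ->
    filt_exact G (i + j)%N (a * b).

Record LND := MkLND {
  lnd_fun :> {linear B -> B};
  lnd_leibniz : forall a b, lnd_fun (a * b) = lnd_fun a * b + a * lnd_fun b;
  lnd_nilp : forall a, exists N, iter N lnd_fun a = 0
}.

Section Derivation.
Variable D : LND.

Definition lnd_ker (a : B) : Prop := D a = 0.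

Definition lnd_ker2 (a : B) : Prop := D (D a) = 0.

Definition plinth (b : B) : Prop := lnd_ker b /\ exists a, b = D a.

Lemma lnd_deg_exists (a : B) : exists i, iter i.+1 D a == 0.
Proof.
by have [N DN] := lnd_nilp D a; exists N; rewrite iterS DN linear0.
Qed.

(* None stands for the degree -oo of 0. *)
Definition lnd_deg (a : B) : option nat :=
  if a == 0 then None else Some (ex_minn (lnd_deg_exists a)).

Definition generates_plinth (m : nat) (b : 'I_m -> B) : Prop :=
  forall a, plinth a <->
    exists c : 'I_m -> B,
      (forall i, lnd_ker (c i)) /\ a = \sum_(i < m) c i * b i.

Lemma lnd_ker2_gen (m : nat) (s : 'I_m -> B) :
  generates_plinth (fun i => D (s i)) -> (forall i, lnd_ker2 (s i)) ->
  forall a, lnd_ker2 a <->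
    exists (c : 'I_m -> B) (c0 : B), [/\ forall i, lnd_ker (c i), lnd_ker c0
      & a = \sum_(i < m) c i * s i + c0].
Proof.
rewrite /lnd_ker /lnd_ker2 => gen s2 a.
have DE c : (forall i, D (c i) = 0) ->
    D (\sum_(i < m) c i * s i) = \sum_(i < m) c i * D (s i).
  move=> c0; rewrite linear_sum; apply: eq_bigr => i _.
  by rewrite lnd_leibniz c0 mul0r add0r.
split=> [a2|[c [c0 [kc kc0 ->]]]].
  have [|c [kc Da]] := (gen (D a)).1; first by split => //; exists a.
  exists c, (a - \sum_(i < m) c i * s i); split=> //; last by rewrite subrKC.
  by rewrite linearB DE // Da subrr.
rewrite linearD DE // kc0 addr0 linear_sum big1 // => i _.
by rewrite lnd_leibniz kc s2 mul0r mulr0 addr0.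
Qed.

(* The sum over the exponents (u, v) with |u| + sum_e d_e v_e <= i of the
   subspaces (ker D) s^u x^v; (u, v) is t = (t.1, t.2) below. *)
Definition monomial_filtration (m n : nat) (s : 'I_m -> B) (x : 'I_n -> B)
    (d : 'I_n -> nat) (i : nat) (b : B) : Prop :=
  exists (ts : seq ('X_{1..m} * 'X_{1..n}))
         (c : 'X_{1..m} * 'X_{1..n} -> B),
    (forall t, t \in ts -> lnd_ker (c t) /\
       (\sum_(a < m) t.1 a + \sum_(e < n) d e * t.2 e <= i)%N) /\
    b = \sum_(t <- ts) c t *
          (\prod_(a < m) s a ^+ t.1 a) * (\prod_(e < n) x e ^+ t.2 e).

End Derivation.
End Algebras.

Section WeightedDegree.
Variables (N : nat) (w : 'I_N -> nat).

Definition wmdeg (u : 'X_{1..N}) : nat := (\sum_(i < N) w i * u i)%N.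

Lemma wmdeg0 : wmdeg 0%MM = 0%N.
Proof. by rewrite /wmdeg big1 // => i _; rewrite mnm0E muln0. Qed.

Lemma wmdegD : {morph wmdeg : u v / (u + v)%MM >-> (u + v)%N}.
Proof.
move=> u v; rewrite /wmdeg -big_split /=; apply: eq_bigr => i _.
by rewrite mnmDE mulnDr.
Qed.

HB.instance Definition _ := isMeasure.Build N wmdeg wmdeg0 wmdegD.

Variable k : fieldType.

(* mmeasure is one more than the maximal weight (and 0 for p = 0). *)
Definition wdegree (p : {mpoly k[N]}) : nat := (mmeasure wmdeg p).-1.

Definition top_component (p : {mpoly k[N]}) : {mpoly k[N]} :=
  pihomog wmdeg (wdegree p) p.

Definition top_ideal (J : {mpoly k[N]} -> Prop) : {mpoly k[N]} -> Prop :=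
  ideal_gen (fun f => exists2 g, J g & f = top_component g).

End WeightedDegree.

(* k[Z_1..Z_r, X_1..X_n, S_1..S_m], the variables being in this order. *)
Section ExtendedRing.
Variables (k : fieldType) (r n m : nat).

Definition varZ (i : 'I_r) : {mpoly k[r + n + m]} :=
  'X_(lshift m (lshift n i)).
Definition varX (i : 'I_n) : {mpoly k[r + n + m]} :=
  'X_(lshift m (rshift r i)).
Definition varS (i : 'I_m) : {mpoly k[r + n + m]} :=
  'X_(rshift (r + n) i).

Definition inclX (p : {mpoly k[n]}) : {mpoly k[r + n + m]} := peval varX p.

Definition var_weight (d : 'I_n -> nat) (i : 'I_(r + n + m)) : nat :=
  match split i with
  | inl j => match split j with inl _ => 0%N | inr e => d e end
  | inr _ => 1%N
  end.

Inductive J_generator (I : {mpoly k[n]} -> Prop) (z : 'I_r -> {mpoly k[n]})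
    (s : 'I_m -> {mpoly k[n]}) : {mpoly k[r + n + m]} -> Prop :=
  | J_gen_I p : I p -> J_generator I z s (inclX p)
  | J_gen_Z i : J_generator I z s (varZ i - inclX (z i))
  | J_gen_S i : J_generator I z s (varS i - inclX (s i)).

Definition ideal_J (I : {mpoly k[n]} -> Prop) (z : 'I_r -> {mpoly k[n]})
    (s : 'I_m -> {mpoly k[n]}) : {mpoly k[r + n + m]} -> Prop :=
  ideal_gen (J_generator I z s).

End ExtendedRing.

(* Main.v *)
(* Write phi for the evaluation (Z, X, S) |-> (z(x), x, s(x)).  It maps k[Z, X, S]
   onto B with kernel J, and G_i is the image of the polynomials of omega-degree at
   most i because ker D = k[z].  For p of degree at most i, phi(p) lies in G_(i-1)
   exactly when p can be reduced modulo J to degree at most i-1, that is, when the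
   degree i component of p lies in hat J; so the graded ring of G is
   k[Z, X, S]/hat J.  Hence G is proper iff hat J is prime on homogeneous elements,
   and since hat J is a homogeneous ideal this means that it is prime. *)
Require Import Defs.
From HB Require Import structures.
From mathcomp Require Import all_boot all_order all_algebra.
From mathcomp Require Import mpoly.
From Stdlib Require Import Classical.

Set Implicit Arguments.
Unset Strict Implicit.
Unset Printing Implicit Defensive.

Import GRing.Theory.
Local Open Scope ring_scope.

(** * Generated ideals, and induction on polynomials *)

Lemma ideal_gen_ideal (A : comNzRingType) (S : A -> Prop) :
  is_ideal (ideal_gen S).
Proof.
split=> [|a b [ta [Sa ->]] [tb [Sb ->]]|a b [tb [Sb ->]]].
- by exists [::]; rewrite big_nil.
- exists (ta ++ tb); rewrite big_cat; split=> // t.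
  by rewrite mem_cat => /orP[/Sa|/Sb].
- exists [seq (a * t.1, t.2) | t <- tb]; rewrite big_map mulr_sumr.
  split=> [t /mapP[u /Sb Su ->] //|].
  by apply: eq_bigr => t _; rewrite mulrA.
Qed.

Lemma mem_ideal_gen (A : comNzRingType) (S : A -> Prop) a :
  S a -> ideal_gen S a.
Proof.
move=> Sa; exists [:: (1, a)]; rewrite big_seq1 mul1r; split=> // t.
by rewrite inE => /eqP->.
Qed.

Lemma idealB (A : comNzRingType) (P : A -> Prop) a b :
  is_ideal P -> P a -> P b -> P (a - b).
Proof. by case=> _ PD PM Pa Pb; apply: PD => //; rewrite -mulN1r; apply: PM. Qed.


(** Constants and variables generate the polynomial ring as a ring. This form suits properties
    stable under sums and products, such as the agreement of two algebra maps. *)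
Lemma mpoly_subalg_ind (k : fieldType) (N : nat) (P : {mpoly k[N]} -> Prop) :
    (forall c, P c%:MP) -> (forall i, P 'X_i) ->
    (forall p q, P p -> P q -> P (p + q)) ->
    (forall p q, P p -> P q -> P (p * q)) ->
  forall p, P p.
Proof.
move=> PC PX PD PM; elim/mpolyind=> [|c u p _ _ Pp]; first by rewrite -mpolyC0.
apply: PD => //; rewrite -mul_mpolyC; apply: (PM) => //; rewrite mpolyXE_id.
apply: big_ind => [||i _]; [by rewrite -mpolyC1|exact: PM|].
by elim: (u i) => [|e IHe]; rewrite ?expr0 -?mpolyC1 // exprS; apply: PM.
Qed.

(** * Evaluation of polynomials as an algebra map *)

Section Evaluation.
Variables (k : fieldType) (B : comAlgType k).

Lemma pevalD (n : nat) (x : 'I_n -> B) : {morph peval x : p q / p + q}.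
Proof. exact: rmorphD. Qed.

Lemma pevalB (n : nat) (x : 'I_n -> B) : {morph peval x : p q / p - q}.
Proof. exact: rmorphB. Qed.

Lemma pevalM (n : nat) (x : 'I_n -> B) : {morph peval x : p q / p * q}.
Proof. exact: rmorphM. Qed.

Lemma peval0 (n : nat) (x : 'I_n -> B) : peval x 0 = 0.
Proof. exact: rmorph0. Qed.

Lemma peval1 (n : nat) (x : 'I_n -> B) : peval x 1 = 1.
Proof. exact: rmorph1. Qed.

Lemma pevalZ (n : nat) (x : 'I_n -> B) c p : peval x (c *: p) = c *: peval x p.
Proof. by rewrite /peval mmapZ mulr_algl. Qed.

Lemma peval_sum (n : nat) (x : 'I_n -> B) (T : Type) (ts : seq T) (P : pred T) F :
  peval x (\sum_(t <- ts | P t) F t) = \sum_(t <- ts | P t) peval x (F t).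
Proof. exact: rmorph_sum. Qed.

Lemma pevalC (n : nat) (x : 'I_n -> B) c : peval x c%:MP = c%:A.
Proof. exact: mmapC. Qed.

Lemma pevalX (n : nat) (x : 'I_n -> B) i : peval x 'X_i = x i.
Proof. by rewrite /peval mmapX mmap1U. Qed.

Lemma peval_mnm (n : nat) (x : 'I_n -> B) u :
  peval x 'X_[u] = \prod_(i < n) x i ^+ u i.
Proof. exact: mmapX. Qed.

Lemma eq_peval (n : nat) (x y : 'I_n -> B) p :
  x =1 y -> peval x p = peval y p.
Proof. by move=> xy; apply: eq_bigr => u _; rewrite (mmap1_eq _ xy). Qed.

End Evaluation.

Lemma peval_comp (k : fieldType) (B : comAlgType k) (n N : nat)
    (x : 'I_n -> B) (Y : 'I_N -> {mpoly k[n]}) p :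
  peval x (peval Y p) = peval (fun i => peval x (Y i)) p.
Proof.
elim/mpoly_subalg_ind: p => [c|i|p q IHp IHq|p q IHp IHq].
- by rewrite [peval Y _]pevalC alg_mpolyC !pevalC.
- by rewrite !pevalX.
- by rewrite !pevalD IHp IHq.
- by rewrite !pevalM IHp IHq.
Qed.

(** * Weighted degree and homogeneous components *)

Section Grading.
Variables (k : fieldType) (N : nat) (w : 'I_N -> nat).
Local Notation poly := {mpoly k[N]}.
Local Notation wsize := (mmeasure (wmdeg w)).
Local Notation wcomp := (pihomog (wmdeg w)).
Implicit Types (p q : poly) (d e i j : nat).

(** Since [wsize] is the degree plus one, and 0 for the zero polynomial, degree at most [d] is
    written [wsize p <= d.+1] throughout, with no exception for 0. *)
Lemma mmeasure_leP p e :
  reflect (forall u, p@_u != 0 -> (wmdeg w u < e)%N) (wsize p <= e)%N.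
Proof.
apply: (iffP idP) => [pe u nz_u|lt_e].
  by apply: leq_trans pe; apply: mmeasure_mnm_lt; rewrite mcoeff_msupp.
rewrite mmeasureE big_seq; apply: (big_ind (fun i => (i <= e)%N)) => //.
  by move=> i j; rewrite geq_max => ->.
by move=> u; rewrite mcoeff_msupp => /lt_e.
Qed.

Lemma mcoeff_pihomog d p u :
  (wcomp d p)@_u = if wmdeg w u == d then p@_u else 0.
Proof.
elim/mpolyind: p => [|c v p _ _ IHp]; first by rewrite linear0 !mcoeff0 if_same.
rewrite linearP /= !mcoeffD !mcoeffZ {}IHp pihomogX !mcoeffX.
have [->|neq_vu] := eqVneq v u.
  by case: eqP; rewrite ?mcoeffX ?eqxx ?mcoeff0 ?mulr0 ?add0r.
by case: (_ v == d); rewrite ?mcoeffX ?(negPf neq_vu) ?mcoeff0 mulr0 !add0r.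
Qed.

Lemma pihomog_small d p : (wsize p <= d)%N -> wcomp d p = 0.
Proof.
move=> /mmeasure_leP lt_pd; apply/mpolyP=> u; rewrite mcoeff_pihomog mcoeff0.
case: eqP => // ud; apply/eqP/negPn/negP => /lt_pd; by rewrite ud ltnn.
Qed.

Lemma mmeasure_pihomog d p : (wsize (wcomp d p) <= d.+1)%N.
Proof.
by apply/mmeasure_leP=> u; rewrite mcoeff_pihomog;
  case: (_ =P d) => [->|_]; rewrite ?eqxx.
Qed.

Lemma mmeasureB_le p q e :
  (wsize p <= e)%N -> (wsize q <= e)%N -> (wsize (p - q) <= e)%N.
Proof.
move=> pe qe; apply: leq_trans (mmeasureD_le _ _ _) _.
by rewrite geq_max mmeasureN pe.
Qed.

Lemma mmeasureB_pihomog d p q :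
    (wsize p <= d.+1)%N -> (wsize q <= d.+1)%N -> wcomp d p = wcomp d q ->
  (wsize (p - q) <= d)%N.
Proof.
move=> pd qd eq_pq; have /mmeasure_leP pqd := mmeasureB_le pd qd.
apply/mmeasure_leP=> u nz_u; have := pqd u nz_u; rewrite ltnS leq_eqVlt.
case/predU1P=> // ud; have := mcoeff_pihomog d (p - q) u.
by rewrite linearB /= eq_pq subrr mcoeff0 ud eqxx
  => /esym/eqP; rewrite (negPf nz_u).
Qed.

Lemma mmeasure_subr_pihomog d p :
  (wsize p <= d.+1)%N -> (wsize (p - wcomp d p) <= d)%N.
Proof.
move=> pd; apply: mmeasureB_pihomog; rewrite ?mmeasure_pihomog //.
by rewrite pihomog_id.
Qed.

(** Only one bound carries a successor, so that [q] may have degree below [j], including [q = 0]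
    with [j = 0]. *)
Lemma mmeasureM_le p q i j :
  (wsize p <= i.+1)%N -> (wsize q <= j)%N -> (wsize (p * q) <= i + j)%N.
Proof.
move=> /mmeasure_leP pi /mmeasure_leP qj; apply/mmeasure_leP=> u.
rewrite -mcoeff_msupp => /msuppM_le/allpairsP[[v1 v2] /= [v1p v2q ->]].
rewrite (wmdegD w) -addnS leq_add //.
  by rewrite -ltnS pi // -mcoeff_msupp.
by rewrite qj // -mcoeff_msupp.
Qed.

(** Multiplication by [q] shifts degrees by [e]. The test [e <= d] is there because [d - e] is
    truncated. *)
Lemma pihomogM_homog d e p q : q \is e.-homog for (wmdeg w) ->
  wcomp d (p * q) = if (e <= d)%N then wcomp (d - e) p * q else 0.
Proof.
move=> qe; elim/mpolyind: p => [|c v p _ _ IHp].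
  by rewrite mul0r !linear0 mul0r if_same.
have vq : 'X_[v] * q \is (wmdeg w v + e).-homog for (wmdeg w).
  by apply: dhomogM => //; rewrite dhomogX.
rewrite mulrDl -scalerAl !linearP /= {}IHp pihomogX.
have [<-|ne_d] := eqVneq (wmdeg w v + e)%N d.
  by rewrite leq_addl addnK eqxx pihomog_dE // mulrDl scalerAl.
rewrite (pihomog_ne0 ne_d vq) scaler0 add0r; case: leqP => // le_ed.
by rewrite -(eqn_add2r e) subnK // (negPf ne_d) scaler0 add0r.
Qed.

Lemma pihomogM_top i j p q :
    (wsize p <= i.+1)%N -> (wsize q <= j.+1)%N ->
  wcomp (i + j) (p * q) = wcomp i p * wcomp j q.
Proof.
move=> pi qj.
have hom : wcomp i p * wcomp j q \is (i + j).-homog for (wmdeg w).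
  by apply: dhomogM; apply: pihomogP.
rewrite -(pihomog_dE hom); apply/eqP; rewrite -subr_eq0 -linearB /=.
(* Each summand on the right has a factor whose top component was removed, hence has degree below
   [i + j]. *)
have -> : p * q - wcomp i p * wcomp j q =
    p * (q - wcomp j q) + wcomp j q * (p - wcomp i p).
  by rewrite !mulrBr ![wcomp j q * _]mulrC addrA subrK.
apply/eqP/pihomog_small; apply: leq_trans (mmeasureD_le _ _ _) _.
rewrite geq_max mmeasureM_le ?mmeasure_subr_pihomog //= addnC.
by rewrite mmeasureM_le ?mmeasure_subr_pihomog ?mmeasure_pihomog.
Qed.

(** * The ideal of highest components *)

Section TopIdeal.
Variables (J : poly -> Prop) (idJ : is_ideal J).
Local Notation J' := (top_ideal w J).

(** Either [g] has degree exactly [d] and its component is a generator, or the component is zero. *)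
Lemma top_ideal_pihomog d g : J g -> (wsize g <= d.+1)%N -> J' (wcomp d g).
Proof.
move=> Jg; rewrite leq_eqVlt => /predU1P[gd|/pihomog_small->].
  apply: mem_ideal_gen; exists g => //.
  by rewrite /top_component /wdegree gd.
by case: (ideal_gen_ideal (fun f => exists2 g, J g & f = top_component w g)).
Qed.

(** Together with [top_ideal_pihomog], this shows that [J'] is homogeneous and that its degree [d]
    part consists of the degree [d] components of elements of [J] of degree at most [d]. *)
Lemma pihomog_top_ideal d f : J' f ->
  exists g, [/\ J g, (wsize g <= d.+1)%N & wcomp d f = wcomp d g].
Proof.
have [J0 JD JM] := idJ.
case=> ts [Jts ->]; elim: ts Jts => [|[a b] ts IHts] Jts.
  by exists 0; rewrite big_nil mmeasure0.
have [t tts|g [Jg gd eq_g]] := IHts; first by apply: Jts; rewrite inE tts orbT.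
have [h Jh /= bE] := Jts _ (mem_head _ _).
rewrite big_cons linearD /= {}eq_g; set e := wdegree w h in bE.
(* The case [h = 0] is apart because [wdegree 0] is 0 by default, so that [wsize h = e.+1] fails. *)
have [h0|nz_h] := eqVneq h 0.
  exists g; split=> //; rewrite bE /top_component h0.
  by rewrite linear0 mulr0 linear0 add0r.
have he : wsize h = e.+1 by rewrite mpolySpred.
have be : b \is e.-homog for (wmdeg w) by rewrite bE; apply: pihomogP.
rewrite (pihomogM_homog _ _ be); case: leqP => [le_ed|_]; last first.
  by exists g; rewrite add0r.
(* Only the degree [d - e] component of [a] contributes in degree [d]. It multiplies all of [h]
   rather than its top component [b], which keeps the product in [J]. *)
exists (wcomp (d - e) a * h + g); split; first by apply: JD => //; apply: JM.
  rewrite (leq_trans (mmeasureD_le _ _ _)) // geq_max gd andbT.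
  by rewrite -(subnK le_ed) -addnS mmeasureM_le ?he // subnK // mmeasure_pihomog.
rewrite linearD /= -{3}(subnK le_ed) pihomogM_top ?he ?mmeasure_pihomog //.
by rewrite pihomog_id bE.
Qed.

(** Induction on the total size: the product of the top components of [f] and [g] is a component of
    [f * g], hence in [J']. So one of these top components is in [J'], and subtracting it lowers the
    size. *)
Lemma top_ideal_prime_homog :
    ~ J' 1 ->
    (forall i j f g, f \is i.-homog for (wmdeg w) ->
       g \is j.-homog for (wmdeg w) -> J' (f * g) -> J' f \/ J' g) ->
  is_prime_ideal J'.
Proof.
move=> J'1 homJ'; have idJ' : is_ideal J' := ideal_gen_ideal _.
have [J'0 J'D J'M] := idJ'.
split=> // f g; move: {2}(wsize f + wsize g)%N (leqnn (wsize f + wsize g)) => e.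
elim: e f g => [|e IHe] f g le_fg J'fg.
  left; suff ->: f = 0 by [].
  by apply/eqP; rewrite -(mmeasure_poly_eq0 (wmdeg w)); move: le_fg; case: mmeasure.
have [-> |nz_f] := eqVneq f 0; first by left.
have [-> |nz_g] := eqVneq g 0; first by right.
have fi := mpolySpred (wmdeg w) nz_f; have gj := mpolySpred (wmdeg w) nz_g.
set i := (wsize f).-1 in fi; set j := (wsize g).-1 in gj.
have [h [Jh hd]] := pihomog_top_ideal (i + j) J'fg.
rewrite pihomogM_top ?fi ?gj // => eq_h.
have [|||J'fi|J'gj] := homJ' i j (wcomp i f) (wcomp j g); rewrite ?pihomogP //.
- by rewrite eq_h; apply: top_ideal_pihomog.
- have [||J'r|J'r] := IHe (f - wcomp i f) g; [| |left|by right].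
  + by rewrite -ltnS (leq_trans _ le_fg) // fi addSn ltnS leq_add2r mmeasure_subr_pihomog ?fi.
  + by rewrite mulrBl; apply: idealB => //; rewrite mulrC; apply: J'M.
  + by rewrite -(subrK (wcomp i f) f); apply: J'D.
- have [||J'r|J'r] := IHe f (g - wcomp j g); [| |by left|right].
  + by rewrite -ltnS (leq_trans _ le_fg) // gj addnS ltnS leq_add2l mmeasure_subr_pihomog ?gj.
  + by rewrite mulrBr; apply: idealB => //; apply: J'M.
  + by rewrite -(subrK (wcomp j g) g); apply: J'D.
Qed.

End TopIdeal.

(** * The filtration induced on a quotient by the weighted degree *)

Section InducedFiltration.
Variables (B : comAlgType k) (domB : GRing.integral_domain_axiom B).
Variables (y : 'I_N -> B) (J : poly -> Prop) (G : nat -> B -> Prop).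
Hypothesis presB : is_presentation y J.
Hypothesis G_image :
  forall i b, G i b <-> exists2 p, (wsize p <= i.+1)%N & b = peval y p.
Local Notation J' := (top_ideal w J).

Let idJ : is_ideal J.
Proof.
have [_ JE] := presB; split=> [|f g|f g]; rewrite !JE ?peval0 //.
  by move=> f0 g0; rewrite pevalD f0 g0 addr0.
by move=> g0; rewrite pevalM g0 mulr0.
Qed.

Lemma image_filtration : is_filtration G.
Proof.
split=> [i|i a|a|i j a b]; rewrite ?G_image.
- split=> [|c a b]; rewrite !G_image.
    by exists 0; rewrite ?mmeasure0 ?peval0.
  case=> p pi -> [q qi ->]; exists (c *: p + q).
    rewrite (leq_trans (mmeasureD_le _ _ _)) // geq_max qi andbT.
    exact: leq_trans (mmeasureZ_le _ _ _) pi.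
  by rewrite pevalD pevalZ.
- by case=> p pi ->; exists p => //; rewrite (leq_trans pi).
- have [p ->] := presB.1 a; exists (wsize p); apply/G_image.
  by exists p.
- case=> p pi -> [q qj ->]; exists (p * q); last by rewrite pevalM.
  by rewrite -addnS mmeasureM_le.
Qed.

(* No case distinction on [i] is needed: [p = 0] is the only polynomial with
   [mmeasure p = 0], which matches the convention G_(-1) = {0}. *)
Lemma filt_exactE i b :
  filt_exact G i b <->
  G i b /\ ~ (exists2 p, (wsize p <= i)%N & b = peval y p).
Proof.
split=> -[Gib nGb]; split=> //; apply: contra_not nGb; case: i Gib => [|i] _.
- by case=> p; rewrite leqn0 mmeasure_poly_eq0 => /eqP-> ->; apply: peval0.
- by rewrite G_image.
- by move->; exists 0; rewrite ?mmeasure0 ?peval0.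
- by rewrite G_image.
Qed.

(** This is the dictionary between exact elements of [G] and nonzero homogeneous classes modulo
    [J']. It also covers [p] of degree below [i], whose component 0 lies in [J']. *)
Lemma filt_exact_peval i p :
  (wsize p <= i.+1)%N -> filt_exact G i (peval y p) <-> ~ J' (wcomp i p).
Proof.
have [_ JE] := presB.
move=> pi; rewrite filt_exactE G_image; split=> [[_ nGp] J'p|nJ'p].
  (* Subtracting [g] does not change the value of [p] and cancels its degree [i] component. *)
  apply: nGp; have [g [/JE g0 gi]] := pihomog_top_ideal idJ i J'p.
  rewrite pihomog_id => eq_pg; exists (p - g); first exact: mmeasureB_pihomog.
  by rewrite pevalB g0 subr0.
split; first by exists p.
case=> q qi eq_pq; apply: nJ'p.
(* Conversely, [p - q] lies in [J] and has the same degree [i] component as [p]. *)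
have -> : wcomp i p = wcomp i (p - q).
  by rewrite linearB /= (pihomog_small qi) subr0.
apply: top_ideal_pihomog.
  by apply/JE; rewrite pevalB eq_pq subrr.
by rewrite mmeasureB_le // leqW.
Qed.

Lemma proper_iff_top_ideal_prime : is_proper G <-> is_prime_ideal J'.
Proof.
split=> [[_ proper]|[_ _ primeJ']].
  apply: top_ideal_prime_homog => // [J'1|i j f g fi gj J'fg].
    (* As 1 is nonzero in [B], it is exact at level 0, which keeps 1 out of [J']. *)
    have ex1 : filt_exact G 0 (peval y 1).
      split; first by apply/G_image; exists 1; rewrite ?mmeasure1.
      by rewrite peval1; apply/eqP/oner_neq0.
    move/filt_exact_peval: ex1; rewrite mmeasure1 pihomog_dE ?dhomog1 //.
    exact.
  have size_homog d (h : poly) : h \is d.-homog for (wmdeg w) -> (wsize h <= d.+1)%N.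
    by move=> hd; rewrite -(pihomog_dE hd) mmeasure_pihomog.
  (* Membership in [J'] is undecided, hence the classical step: if neither factor were in [J'],
     properness would make the value of the product exact. *)
  apply: NNPP => /not_or_and[nJ'f nJ'g].
  have fgij : f * g \is (i + j).-homog for (wmdeg w) by apply: dhomogM.
  have : filt_exact G (i + j) (peval y (f * g)).
    rewrite pevalM; apply: proper.
      by apply/filt_exact_peval; rewrite ?size_homog // pihomog_dE.
    by apply/filt_exact_peval; rewrite ?size_homog // pihomog_dE.
  by move/filt_exact_peval; rewrite size_homog // pihomog_dE //; apply.
split; first exact: image_filtration.
move=> i j a b exa exb.
have [/G_image[p pi aE] _] := exa; have [/G_image[q qj bE] _] := exb.
rewrite {}aE {}bE in exa exb *.
rewrite -pevalM; apply/filt_exact_peval; first by rewrite -addnS mmeasureM_le.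
rewrite pihomogM_top // => /primeJ'.
by case; apply/filt_exact_peval.
Qed.

End InducedFiltration.
End Grading.
Lemma wmdeg1 (N : nat) (w : 'I_N -> nat) i : wmdeg w U_(i) = w i.
Proof.
rewrite /wmdeg (bigD1 i) //= mnm1E eqxx muln1 big1 ?addn0 // => j ne_ji.
by rewrite mnm1E eq_sym (negPf ne_ji) muln0.
Qed.

(** * Splitting variables and exponents into the blocks Z, X and S *)

Section Split3.
Variables (r n m : nat).

(** The nested [split] copies that of [var_weight], so the lemmas below rewrite weights too, up to
    conversion. *)
Definition fun3 (T : Type) (f : 'I_r -> T) (g : 'I_n -> T) (h : 'I_m -> T)
    (i : 'I_(r + n + m)) : T :=
  match split i with
  | inl j => match split j with inl a => f a | inr b => g b end
  | inr c => h c
  end.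

Variables (T : Type) (f : 'I_r -> T) (g : 'I_n -> T) (h : 'I_m -> T).

Lemma fun3l i : fun3 f g h (lshift m (lshift n i)) = f i.
Proof. by rewrite /fun3 (unsplitK (inl _)) (unsplitK (inl _)). Qed.

Lemma fun3m i : fun3 f g h (lshift m (rshift r i)) = g i.
Proof. by rewrite /fun3 (unsplitK (inl _)) (unsplitK (inr _)). Qed.

Lemma fun3r i : fun3 f g h (rshift (r + n) i) = h i.
Proof. by rewrite /fun3 (unsplitK (inr _)). Qed.

End Split3.

Section SplitMonomial.
Variables (r n m : nat) (u : 'X_{1..r + n + m}).

Definition mnmZ : 'X_{1..r} := [multinom u (lshift m (lshift n i)) | i < r].
Definition mnmX : 'X_{1..n} := [multinom u (lshift m (rshift r i)) | i < n].
Definition mnmS : 'X_{1..m} := [multinom u (rshift (r + n) i) | i < m].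

(** The Z variables have weight 0, which leaves exactly the quantity bounded in
    [monomial_filtration]. *)
Lemma wmdeg_split3 d :
  wmdeg (var_weight d) u =
    (\sum_(a < m) mnmS a + \sum_(e < n) d e * mnmX e)%N.
Proof.
rewrite /wmdeg !big_split_ord /= big1 => [|i _]; last first.
  by rewrite [var_weight _ _]fun3l mul0n.
rewrite add0n addnC; congr (_ + _)%N; apply: eq_bigr => i _; rewrite mnmE.
  by rewrite [var_weight _ _]fun3r mul1n.
by rewrite [var_weight _ _]fun3m.
Qed.

End SplitMonomial.

Lemma prod_split3 (R : comNzRingType) (r n m : nat) (f : 'I_r -> R)
    (g : 'I_n -> R) (h : 'I_m -> R) (u : 'X_{1..r + n + m}) :
  \prod_i fun3 f g h i ^+ u i =
    (\prod_(i < r) f i ^+ mnmZ u i) * (\prod_(i < m) h i ^+ mnmS u i) *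
      (\prod_(i < n) g i ^+ mnmX u i).
Proof.
rewrite !big_split_ord /= mulrAC.
congr (_ * _ * _); apply: eq_bigr => i _; rewrite mnmE.
- by rewrite fun3l.
- by rewrite fun3r.
- by rewrite fun3m.
Qed.

(** * Presentation of [B] as a quotient of the extended ring *)

Section ExtendedPresentation.
Variables (k : fieldType) (B : comAlgType k) (r n m : nat) (x : 'I_n -> B).
Variables (I : {mpoly k[n]} -> Prop) (presB : is_presentation x I).
Variables (z : 'I_r -> {mpoly k[n]}) (s : 'I_m -> {mpoly k[n]}).

Let Y : 'I_(r + n + m) -> {mpoly k[n]} := fun3 z (fun i => 'X_i) s.
Let y i := peval x (Y i).

Lemma peval_inclX p : peval y (inclX r m p) = peval x p.
Proof.
rewrite /inclX peval_comp; apply: eq_peval => i.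
by rewrite /varX pevalX /y /Y fun3m pevalX.
Qed.

(** The generators of [J] make each variable congruent to its image under [Y], and congruences
    respect sums and products. *)
Lemma ideal_J_subst p : ideal_J I z s (p - inclX r m (peval Y p)).
Proof.
have idJ : is_ideal (ideal_J I z s) := ideal_gen_ideal _.
have [J0 JD JM] := idJ.
elim/mpoly_subalg_ind: p => [c|i|p q IHp IHq|p q IHp IHq].
- by rewrite /inclX !(pevalC, alg_mpolyC) subrr.
- rewrite pevalX /Y; case: (split_ordP i) => [j ->|j ->]; last first.
    by rewrite fun3r; apply/mem_ideal_gen/J_gen_S.
  case: (split_ordP j) => [a ->|a ->].
    by rewrite fun3l; apply/mem_ideal_gen/J_gen_Z.
  by rewrite fun3m /inclX pevalX subrr.
- rewrite /inclX !pevalD opprD addrACA.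
  exact: JD.
- rewrite /inclX !pevalM -!/(inclX _ _ _).
  set p' := inclX r m _; set q' := inclX r m _.
  have -> : p * q - p' * q' = q * (p - p') + p' * (q - q').
    by rewrite !mulrBr ![q * _]mulrC addrA subrK.
  by apply: JD; apply: JM.
Qed.

(** If [p] vanishes at [y], then substituting [Y] gives an element of [I], to which [p] is congruent
    modulo [J]. *)
Lemma is_presentation_ext : is_presentation y (ideal_J I z s).
Proof.
have [surj ker] := presB.
split=> [b|p].
  by have [p ->] := surj b; exists (inclX r m p); rewrite peval_inclX.
split=> [[ts [Jts ->]]|p0].
  rewrite peval_sum big_seq big1 // => t /Jts Jt.
  rewrite pevalM.
  suff -> : peval y t.2 = 0 by rewrite mulr0.
  case: t.2 / Jt => [q /ker|i|i]; first by rewrite peval_inclX.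
    rewrite !pevalB peval_inclX /varZ pevalX.
    by rewrite /y /Y fun3l subrr.
  rewrite !pevalB peval_inclX /varS pevalX.
  by rewrite /y /Y fun3r subrr.
have [_ JD _] := ideal_gen_ideal (J_generator I z s).
rewrite -(subrK (inclX r m (peval Y p)) p); apply: JD.
  exact: ideal_J_subst.
by apply/mem_ideal_gen/J_gen_I/ker; rewrite peval_comp.
Qed.

(** * The monomial filtration as an image of the degree filtration *)

Section MonomialFiltration.
Variables (D : LND B) (d : 'I_n -> nat).
Hypothesis z_gen :
  forall b, lnd_ker D b <-> subalg_gen (fun i => peval x (z i)) b.
Local Notation wsize := (mmeasure (wmdeg (@var_weight r n m d))).

Let yE : y =1 fun3 (fun i => peval x (z i)) x (fun i => peval x (s i)).
Proof.
by move=> i; rewrite /y /Y /fun3; case: split => // j; case: split => // a;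
  rewrite pevalX.
Qed.

Lemma mmeasure_peval_varZ (q : {mpoly k[r]}) :
  (wsize (peval (varZ k n m) q) <= 1)%N.
Proof.
elim/mpoly_subalg_ind: q => [c|i|p q IHp IHq|p q IHp IHq].
- by rewrite pevalC (leq_trans (mmeasureZ_le _ _ _)) // mmeasure1.
- by rewrite pevalX mmeasureX ltnS /= wmdeg1 [var_weight _ _]fun3l.
- rewrite !pevalD (leq_trans (mmeasureD_le _ _ _)) //.
  by rewrite geq_max IHp.
- rewrite !pevalM.
  exact: (@mmeasureM_le _ _ _ _ _ 0 1).
Qed.

(** A kernel coefficient lifts to a polynomial in the Z variables, of weight 0. Conversely,
    collecting the terms of [p] with equal X and S exponents gives kernel coefficients. *)
Lemma monomial_filtration_image i b :
  monomial_filtration D (fun i => peval x (s i)) x d i b <->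
  exists2 p, (wsize p <= i.+1)%N & b = peval y p.
Proof.
split.
  case=> ts [c [cP ->]]; rewrite big_seq; elim/big_rec: _ => [|t b' ts_t].
    by exists 0; rewrite ?mmeasure0 // peval0.
  case=> p pi ->; have [/z_gen[q ->] ti] := cP t ts_t.
  (* The Z exponents of [u] are zero because the coefficient is carried by [q]. *)
  pose u : 'X_{1..r + n + m} := [multinom fun3 (fun=> 0%N) t.2 t.1 j | j < r + n + m].
  have uZ : mnmZ u = 0%MM by apply/mnmP=> j; rewrite !mnmE fun3l.
  have uX : mnmX u = t.2 by apply/mnmP=> j; rewrite !mnmE fun3m.
  have uS : mnmS u = t.1 by apply/mnmP=> j; rewrite !mnmE fun3r.
  exists (peval (varZ k n m) q * 'X_[u] + p).
    rewrite (leq_trans (mmeasureD_le _ _ _)) // geq_max pi andbT -[i.+1]add0n.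
    apply: mmeasureM_le; first exact: mmeasure_peval_varZ.
    by rewrite mmeasureX ltnS /= wmdeg_split3 uX uS.
  rewrite pevalD pevalM peval_mnm peval_comp.
  rewrite -mulrA; congr (_ * _ + _).
    by apply: eq_peval => j; rewrite pevalX yE fun3l.
  rewrite (eq_bigr _ (fun j _ => congr1 (fun b => b ^+ u j) (yE j))) prod_split3.
  by rewrite uZ uX uS [X in X * _ * _]big1 ?mul1r // => j _; rewrite mnm0E expr0.
case=> p /mmeasure_leP pi ->.
pose F u := p@_u *: \prod_(j < r) peval x (z j) ^+ mnmZ u j.
pose xs (u : 'X_{1..r + n + m}) := (mnmS u, mnmX u).
(* The coefficient of a pair already sums over all monomials of [p] above it, so each pair must be
   listed once. *)
exists (undup (map xs (msupp p))), (fun t => \sum_(u <- msupp p | xs u == t) F u).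
split=> [t|].
  rewrite mem_undup => /mapP[u up ->]; split; last first.
    by rewrite -ltnS -wmdeg_split3 pi // -mcoeff_msupp.
  apply/z_gen; exists (\sum_(v <- msupp p | xs v == xs u) p@_v *: 'X_[mnmZ v]).
  by rewrite peval_sum; apply: eq_bigr => v _; rewrite pevalZ peval_mnm.
transitivity (\sum_(u <- msupp p) F u * (\prod_(a < m) peval x (s a) ^+ mnmS u a)
    * \prod_(e < n) x e ^+ mnmX u e).
  rewrite {1}[p]mpolyE peval_sum; apply: eq_bigr => u _.
  rewrite pevalZ peval_mnm.
  rewrite (eq_bigr _ (fun j _ => congr1 (fun b => b ^+ u j) (yE j))) prod_split3.
  by rewrite -!scalerAl.
under [RHS]eq_bigr do rewrite !mulr_suml.
(* After the exchange of sums, each monomial [u] meets the single pair [xs u]. *)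
rewrite (exchange_big_dep predT) //= big_seq [RHS]big_seq.
apply: eq_bigr => u up; rewrite -[RHS]big_filter.
rewrite (_ : filter _ _ = [:: xs u]) ?big_seq1 //.
rewrite (eq_filter (a2 := pred1 (xs u))) => [|t]; last exact: eq_sym.
by rewrite filter_pred1_uniq ?undup_uniq // mem_undup map_f.
Qed.

End MonomialFiltration.
End ExtendedPresentation.

Theorem proposition2p4 (k : fieldType) (char0 : [pchar k] =i pred0)
    (n : nat) (B : comAlgType k) (domB : GRing.integral_domain_axiom B)
    (x : 'I_n -> B) (I : {mpoly k[n]} -> Prop)
    (presB : is_presentation x I)
    (I_sub : forall p, I p -> ideal_gen (fun q => exists i : 'I_n, q = 'X_i) p)
    (D : LND B)
    (r : nat) (z : 'I_r -> {mpoly k[n]})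
    (z_gen : forall b, lnd_ker D b <-> subalg_gen (fun i => peval x (z i)) b)
    (z_at0 : forall i, (z i).@[fun=> 0] = 0)
    (m : nat) (s : 'I_m -> {mpoly k[n]})
    (s_ker2 : forall i, lnd_ker2 D (peval x (s i)))
    (s_at0 : forall i, (s i).@[fun=> 0] = 0)
    (s_gen : generates_plinth D (fun i => D (peval x (s i))))
    (x_neq0 : forall i, x i != 0)
    (d : 'I_n -> nat) (d_deg : forall i, lnd_deg D (x i) = Some (d i)) :
  is_proper (monomial_filtration D (fun i => peval x (s i)) x d) <->
  is_prime_ideal (top_ideal (@var_weight r n m d) (ideal_J I z s)).
Proof.
apply: proper_iff_top_ideal_prime; first exact: is_presentation_ext presB z s.
exact: monomial_filtration_image.
Qed.
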